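(* Let $N\ge 2$ be an integer, $s\ge 0$, $t\ge 1$, and $0<\alpha<1/2$. Then $\omega_N$ is a minimal $N$-point $s,\log^t$-energy configuration on $\mathbb{S}^1_\alpha$ with the Euclidean metric $d_u$ if and only if $\omega_N$ is a configuration of $N$ distinct equally spaced points on $\mathbb{S}^1_\alpha$.
   Context: $d_u$ is the Euclidean metric of $\mathbb{R}^2$ and $\mathbb{S}^1_\alpha:=\{x\in\mathbb{R}^2: d_u(0,x)=\alpha\}$ is the circle of radius $\alpha$ centered at $0$. For a metric space $(A,d)$ and a set $\omega_N\subset A$ of $N$ distinct points, $$E^s_{\log^t}(\omega_N):=\sum_{\substack{x\ne y\\ x,y\in\omega_N}}\frac{1}{d(x,y)^s}\left(\log\frac{1}{d(x,y)}\right)^t$$ (sum over ordered pairs of distinct points). A minimal $N$-point $s,\log^t$-energy configuration on $A$ with the metric $d$ is a set $\omega_N\subset A$ of $N$ distinct points minimizing $E^s_{\log^t}$ among all sets of $N$ distinct points of $A$; here $A=\mathbb{S}^1_\alpha$, $d=d_u$. Points are equally spaced on the circle if consecutive ones are separated by arcs of equal length $2\pi\alpha/N$. *)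

(* Defs.v *)
From HB Require Import structures.
From mathcomp Require Export all_boot all_order all_algebra finmap.
From mathcomp Require Export all_classical all_reals all_analysis.

Set Implicit Arguments.
Unset Strict Implicit.
Unset Printing Implicit Defensive.

Import Order.TTheory GRing.Theory Num.Theory.

Local Open Scope classical_set_scope.
Local Open Scope ring_scope.

Section Energy.
Context {R : realType} {T : choiceType}.
Implicit Types (d : T -> T -> R) (A : set T) (w : {fset T}).

Definition configuration A (N : nat) w : Prop :=
  [set` w] `<=` A /\ #|` w|%fset = N.

(* `^ is the real power powR; the logarithm is positive, so that its real     *)
(* power is the usual one, when the distances are smaller than 1.             *)
Definition log_energy (s t : R) d w : R :=
  \sum_(x <- w) \sum_(y <- w | x != y)
    (d x y `^ s)^-1 * (ln ((d x y)^-1)) `^ t.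

Definition minimal_configuration (s t : R) A d (N : nat) w : Prop :=
  configuration A N w /\
  forall w', configuration A N w' -> log_energy s t d w <= log_energy s t d w'.

End Energy.

Section Circle.
Context {R : realType}.

(* The library norm on R * R is the sup norm, hence the explicit formula. *)
Definition euclidean_dist (x y : R * R) : R :=
  Num.sqrt ((x.1 - y.1) ^+ 2 + (x.2 - y.2) ^+ 2).

Definition circle (alpha : R) : set (R * R) :=
  [set x | euclidean_dist 0 x = alpha].

Definition circle_point (alpha theta : R) : R * R :=
  (alpha * cos theta, alpha * sin theta).

(* theta 0 < ... < theta N.-1 < theta 0 + 2 pi are the angles of the points   *)
(* of w, met in this order in one counterclockwise turn; theta N closes the   *)
(* turn, so that consecutive points, cyclically, have indices k and k.+1 with *)
(* k < N.                                                                     *)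
Definition angular_enumeration (alpha : R) (N : nat) (w : {fset R * R})
    (theta : nat -> R) : Prop :=
  [/\ forall k, (k < N)%N -> theta k < theta k.+1,
      theta N = theta 0%N + 2 * pi
    & [set` w] = [set circle_point alpha (theta k) | k in `I_N] ].

Definition equally_spaced (alpha : R) (N : nat) (w : {fset R * R}) : Prop :=
  exists2 theta, angular_enumeration alpha N w theta &
    forall k, (k < N)%N ->
      alpha * (theta k.+1 - theta k) = 2 * pi * alpha / N%:R.

End Circle.

(* Main.v *)
From mathcomp Require Import ring lra zify.
Require Import Defs.

Set Implicit Arguments.
Unset Strict Implicit.
Unset Printing Implicit Defensive.

Import Order.TTheory GRing.Theory Num.Theory.
Import numFieldNormedType.Exports.

Local Open Scope ring_scope.

(** Two points of the circle that subtend the angle [phi] contribute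
    [g phi = F (h phi)] to the energy, where [h phi] is minus the logarithm of
    the chord [2 alpha sin (phi / 2)] and [F u = exp (s u) u ^ t]. Since the
    diameter [2 alpha] is less than [1], [h] is positive; it is strictly convex
    on the interval from [0] to [2 pi], and [F] is convex and increasing on the
    positive reals. Hence [g] is strictly convex, which is used in the form of a
    strict supporting line at every angle ([pair_energy_gt_line]).

    List the points counterclockwise by angles [theta i], continued to all
    natural numbers by [theta (i + N) = theta i + 2 pi]. The energy is then the
    sum over [0 < k < N] of the sums over one period of
    [g (theta (i + k) - theta i)] ([log_energy_winding]). For fixed [k] the [N]
    gaps have the sum [2 pi k] whatever the configuration, so Jensen's inequality
    bounds the [k]-th part below by its value for equal gaps
    ([leif_sum_supporting_line]). All these bounds are attained together by
    equally spaced points, and equality for [k = 1] forces the consecutive gaps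
    to be equal ([log_energy_ge]). *)

(** * Convexity of the pair energy as a function of the angle *)

Section Convexity.
Context {R : realType}.
Implicit Types (s t u v x alpha phi : R).

(** Strict concavity of [sin] on [[0, pi]]: by the mean value theorem the chord
    from [x0] to [x] has slope [cos c] with [c] between them, and [cos] is
    decreasing. *)
Lemma sin_lt_tangent x0 x : 0 < x0 < pi -> 0 < x < pi -> x != x0 ->
  sin x < sin x0 + cos x0 * (x - x0).
Proof.
move=> x0pi xpi; rewrite neq_lt.
have mvt (a b : R) : a < b -> exists2 c, c \in `]a, b[ & sin b - sin a = cos c * (b - a).
  move=> ab; apply: MVT => //.
  by apply: continuous_subspaceT => z; exact: continuous_sin.
case/orP=> /[dup] xx0 /mvt[c]; rewrite in_itv /= => cx e.
- have : cos x0 < cos c by rewrite ltr_cos ?in_itv /=; lra.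
  by rewrite -subr_gt0 => cc; nra.
- have : cos c < cos x0 by rewrite ltr_cos ?in_itv /=; lra.
  by rewrite -subr_gt0 => cc; nra.
Qed.

(** The bound [ln y <= y - 1] at [y = sin x / sin x0] reduces the strict
    convexity of [- ln sin] to the strict concavity of [sin]. *)
Lemma ln_sin_lt_tangent x0 x : 0 < x0 < pi -> 0 < x < pi -> x != x0 ->
  ln (sin x) < ln (sin x0) + cos x0 / sin x0 * (x - x0).
Proof.
move=> x0pi xpi xx0.
have := sin_lt_tangent x0pi xpi xx0.
have := sin_gt0_pi x0pi; have := sin_gt0_pi xpi.
move: (sin x) (sin x0) (cos x0) => S S0 C0 S_gt0 S0_gt0 SS.
have q_gt0 : 0 < S / S0 by rewrite divr_gt0.
have := @le_ln1Dx _ (S / S0 - 1); rewrite subrKC ln_div // => /(_ ltac:(lra)).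
have : S / S0 < 1 + C0 / S0 * (x - x0).
  rewrite ltr_pdivrMr //; apply: (lt_le_trans SS); rewrite le_eqVlt; apply/orP; left.
  by apply/eqP; field; rewrite gt_eqF.
lra.
Qed.

(** Bernoulli's inequality: when [y = 1 + t (v - 1)] is positive, bounding
    [ln (1 / v)] and [ln (y / v)] by [ln z <= z - 1] gives [ln y <= t ln v]. *)
Lemma powR_ge_bernoulli t v : 1 <= t -> 0 < v -> 1 + t * (v - 1) <= v `^ t.
Proof.
move=> t1 v0.
have [y_le0|y_gt0] := leP (1 + t * (v - 1)) 0; first exact: le_trans (powR_ge0 _ _).
have ln_le z : 0 < z -> ln z <= z - 1 :> R.
  by move=> z0; have := @le_ln1Dx _ (z - 1); rewrite subrKC; apply; lra.
rewrite -ler_ln ?posrE ?powR_gt0 // ln_powR.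
set y := 1 + _ in y_gt0 *.
have := ln_le (y / v) (divr_gt0 y_gt0 v0); rewrite ln_div // => lny.
have vi : 0 < v^-1 by rewrite invr_gt0.
have := ln_le _ vi; rewrite lnV // => lnv.
have e : (t - 1) * (v^-1 - 1) + (y / v - 1) = 0.
  by rewrite /y; field; rewrite gt_eqF.
nra.
Qed.

Lemma powR_ge_tangent t u0 u : 1 <= t -> 0 < u0 -> 0 < u ->
  u0 `^ t + t * u0 `^ (t - 1) * (u - u0) <= u `^ t.
Proof.
move=> t1 u00 u_gt0.
have q_gt0 := divr_gt0 u_gt0 u00.
have := powR_ge_bernoulli t1 q_gt0.
rewrite -(ler_pM2l (powR_gt0 t u00)) -(powRM _ (ltW u00) (ltW q_gt0)).
rewrite [u0 * _]mulrC divfK ?gt_eqF //; apply: le_trans.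
rewrite -(mulr_powRB1 (ltW u00)) ?(lt_le_trans _ t1) // le_eqVlt.
by apply/orP; left; apply/eqP; field; rewrite gt_eqF.
Qed.

(** Both factors of [expR (s u) * u `^ t] are nondecreasing and convex. With
    [A0], [A] and [B0], [B] for their values at [u0] and [u], monotonicity is
    [(A - A0) (B - B0) >= 0], so [A B >= A0 B0 + B0 (A - A0) + A0 (B - B0)], and
    the tangent lines of the factors combine into a line for the product. Its
    slope is positive because the slope of the power is. *)
Lemma expR_powR_ge_line s t u0 : 0 <= s -> 1 <= t -> 0 < u0 ->
  exists2 m, 0 < m & forall u, 0 < u ->
    expR (s * u0) * u0 `^ t + m * (u - u0) <= expR (s * u) * u `^ t.
Proof.
move=> s0 t1 u00.
set A0 := expR (s * u0); set B0 := u0 `^ t.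
have A0_gt0 : 0 < A0 := expR_gt0 _.
have B0_gt0 : 0 < B0 by exact: powR_gt0.
have p_gt0 : 0 < u0 `^ (t - 1) by exact: powR_gt0.
exists (B0 * (A0 * s) + A0 * (t * u0 `^ (t - 1))).
  rewrite ltr_wpDl ?mulr_ge0 ?mulr_gt0 //; try exact: ltW.
  exact: lt_le_trans t1.
move=> u u_gt0.
have tB := powR_ge_tangent t1 u00 u_gt0.
have tA : A0 + A0 * s * (u - u0) <= expR (s * u).
  have -> : s * u = s * u0 + s * (u - u0) by ring.
  rewrite expRD -/A0.
  have := expR_ge1Dx (s * (u - u0)).
  by rewrite -(ler_pM2l A0_gt0) mulrDr mulr1 mulrA.
have mono : 0 <= (expR (s * u) - A0) * (u `^ t - B0).
  have [uu0|uu0] := leP u0 u.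
  - apply: mulr_ge0; rewrite subr_ge0; first by rewrite ler_expR ler_wpM2l.
    by apply: ge0_ler_powR; rewrite ?nnegrE; lra.
  - apply: mulr_le0; rewrite subr_le0; first by rewrite ler_expR ler_wpM2l // ltW.
    by apply: ge0_ler_powR; rewrite ?nnegrE; lra.
have hA := ler_wpM2l (ltW B0_gt0) tA.
have hB := ler_wpM2l (ltW A0_gt0) tB.
rewrite -/B0 in hB; lra.
Qed.

Definition pair_energy s t r := (r `^ s)^-1 * (ln r^-1) `^ t : R.

(** [2 alpha sin (phi / 2)] is the length of the chord that subtends the angle
    [phi] on the circle of radius [alpha]. *)
Definition chord alpha phi := 2 * alpha * sin (phi / 2) : R.

Lemma half_itv phi : 0 < phi < 2 * pi -> 0 < phi / 2 < pi.
Proof. by move=> h; lra. Qed.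

Lemma chord_gt0 alpha phi : 0 < alpha -> 0 < phi < 2 * pi -> 0 < chord alpha phi.
Proof. by move=> a0 h; rewrite !mulr_gt0 // sin_gt0_pi // half_itv. Qed.

Lemma pair_energyE s t r : 0 < r ->
  pair_energy s t r = expR (s * - ln r) * (- ln r) `^ t.
Proof.
by move=> r0; rewrite /pair_energy lnV ?posrE // -powRN /powR gt_eqF // mulNr mulrN.
Qed.

(** [pair_energy s t (chord alpha phi)] is the increasing convex function
    [expR (s u) * u `^ t] of [u = - ln (2 alpha) - ln (sin (phi / 2))], which is
    strictly convex in [phi] and positive because the diameter is less than [1].
    Convexity is expressed by a strict supporting line at each angle. *)
Lemma pair_energy_gt_line s t alpha phi0 :
  0 <= s -> 1 <= t -> 0 < alpha < 1 / 2 -> 0 < phi0 < 2 * pi ->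
  exists m, forall phi, 0 < phi < 2 * pi -> phi != phi0 ->
    pair_energy s t (chord alpha phi0) + m * (phi - phi0) <
    pair_energy s t (chord alpha phi).
Proof.
move=> s0 t1 /andP[a0 a1] h0.
have ln_chord phi : 0 < phi < 2 * pi ->
    ln (chord alpha phi) = ln (2 * alpha) + ln (sin (phi / 2)).
  by move=> h; rewrite [LHS]lnM // posrE ?mulr_gt0 // sin_gt0_pi // half_itv.
have u_gt0 phi : 0 < phi < 2 * pi -> 0 < - ln (chord alpha phi).
  move=> h; rewrite oppr_gt0 ln_lt0 // chord_gt0 //= /chord.
  have := sin_le1 (phi / 2); have := sin_gt0_pi (half_itv h); nra.
have [m m0 mP] := expR_powR_ge_line s0 t1 (u_gt0 _ h0).
exists (m * (- (cos (phi0 / 2) / sin (phi0 / 2)) / 2)) => phi h ne.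
rewrite !pair_energyE ?chord_gt0 //.
apply: lt_le_trans (mP _ (u_gt0 _ h)).
rewrite ltrD2l -mulrA ltr_pM2l // !ln_chord //.
have ne2 : phi / 2 != phi0 / 2 by apply: contra ne => /eqP e; apply/eqP; lra.
have := ln_sin_lt_tangent (half_itv h0) (half_itv h) ne2.
lra.
Qed.

End Convexity.

(** * Jensen's inequality and sums over a moving window *)

(** Jensen's inequality with its equality case, from a strict supporting line at
    the mean: the linear terms of the line cancel in the sum. *)
Lemma leif_sum_supporting_line (R : realType) (I : finType) (D : R -> bool)
    (g : R -> R) (x0 : R) (x : I -> R) :
  (exists m, forall y, D y -> y != x0 -> g x0 + m * (y - x0) < g y) ->
  (forall i, D (x i)) -> \sum_i x i = #|I|%:R * x0 ->
  #|I|%:R * g x0 <= \sum_i g (x i) ?= iff [forall i, x i == x0].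
Proof.
move=> [m line] Dx mean.
have -> : #|I|%:R * g x0 = \sum_i (g x0 + m * (x i - x0)).
  rewrite big_split /= -mulr_sumr sumrB mean !sumr_const.
  by rewrite !mulr_natl subrr mulr0 addr0.
rewrite -[X in _ <= _ ?= iff X]/[forall (i | true), x i == x0].
apply: leif_sum => i _; apply/leifP.
have [->|ne] := eqVneq (x i) x0; first by rewrite subrr mulr0 addr0.
exact: line.
Qed.

(** Shifting a window of length [N] by one replaces [f k] by
    [f (k + N) = f k + c]. *)
Lemma sum_shifted_window (V : zmodType) (f : nat -> V) (N k : nat) (c : V) :
  (forall i, f (i + N)%N = f i + c) ->
  \sum_(0 <= i < N) f (i + k)%N = \sum_(0 <= i < N) f i + c *+ k.
Proof.
move=> fN; elim: k => [|k IHk].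
  by rewrite mulr0n addr0; apply: eq_bigr => i _; rewrite addn0.
rewrite mulrSr addrA -{}IHk; apply: (@addrI _ (f k)).
have -> : f k + \sum_(0 <= i < N) f (i + k.+1)%N = \sum_(0 <= i < N.+1) f (i + k)%N.
  rewrite big_nat_recl // add0n; congr (_ + _).
  by apply: eq_bigr => i _; rewrite addnS.
by rewrite big_nat_recr //= [(N + k)%N]addnC fN addrCA addrC -!addrA [c + _]addrC.
Qed.

(** * Angles and points of the circle *)

Section Angles.
Context {R : realType}.
Implicit Types (s t alpha a b d : R) (theta : nat -> R) (N : nat).
Implicit Types (w : {fset R * R}).

Lemma circle_point_turn alpha a :
  circle_point alpha (a + 2 * pi) = circle_point alpha a.
Proof. by rewrite /circle_point mulr_natl cosD2pi sinD2pi. Qed.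

Lemma euclidean_dist_circle_point alpha a b : 0 < alpha -> 0 < b - a < 2 * pi ->
  euclidean_dist (circle_point alpha a) (circle_point alpha b) = chord alpha (b - a).
Proof.
move=> a0 ab; rewrite -[RHS]gtr0_norm ?chord_gt0 // -sqrtr_sqr; congr (Num.sqrt _).
rewrite /chord /=; set h := (b - a) / 2.
have -> : b = a + h *+ 2 by rewrite /h; lra.
rewrite cosD sinD cos_mulr2n sin_mulr2n.
have := cos2Dsin2 a; have := cos2Dsin2 h.
move: (cos a) (sin a) (cos h) (sin h) => ca sa ch sh eh ea.
have {}eh : ch ^+ 2 = 1 - sh ^+ 2 by rewrite -eh addrK.
have {}ea : ca ^+ 2 = 1 - sa ^+ 2 by rewrite -ea addrK.
ring: ea eh.
Qed.

Lemma circle_point_neq alpha a b : 0 < alpha -> 0 < b - a < 2 * pi ->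
  circle_point alpha a != circle_point alpha b.
Proof.
move=> a0 ab; apply/eqP => e.
have := euclidean_dist_circle_point a0 ab; rewrite -e /euclidean_dist !subrr.
rewrite expr0n addr0 sqrtr0 => c0.
by have := chord_gt0 a0 ab; rewrite -c0 ltxx.
Qed.

Lemma circle_point_on_circle alpha a : 0 < alpha ->
  circle alpha (circle_point alpha a).
Proof.
move=> a0; rewrite /circle /euclidean_dist /= !sub0r !sqrrN !exprMn -mulrDr.
by rewrite cos2Dsin2 mulr1 sqrtr_sqr gtr0_norm.
Qed.

Definition polar_angle alpha (p : R * R) : R :=
  if 0 <= p.2 then acos (p.1 / alpha) else 2 * pi - acos (p.1 / alpha).

Lemma polar_angleP alpha p : 0 < alpha -> circle alpha p ->
  0 <= polar_angle alpha p < 2 * pi /\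
  circle_point alpha (polar_angle alpha p) = p.
Proof.
case: p => x y a0; rewrite /circle /euclidean_dist /= !sub0r !sqrrN => dist.
have xy : x ^+ 2 + y ^+ 2 = alpha ^+ 2.
  by rewrite -dist sqr_sqrtr // addr_ge0 // sqr_ge0.
set c := x / alpha.
have xE : x = alpha * c by rewrite /c mulrC divfK // gt_eqF.
have y2 : y ^+ 2 = alpha ^+ 2 * (1 - c ^+ 2) by rewrite mulrBr mulr1 -exprMn -xE -xy; ring.
have a2 : 0 < alpha ^+ 2 by rewrite exprn_gt0.
have c2 : 0 <= 1 - c ^+ 2 by rewrite -(pmulr_rge0 _ a2) -y2 sqr_ge0.
have c1 : -1 <= c <= 1 by apply/andP; split; nra.
have sinE : alpha * sin (acos c) = `|y|.
  rewrite sin_acos // -sqrtr_sqr y2 sqrtrM ?sqrtr_sqr ?gtr0_norm //.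
  exact: ltW.
have cosE : cos (acos c) = c by rewrite acosK // in_itv.
have acos_ge := acos_ge0 c1; have acos_le := acos_lepi c1.
have pi0 := pi_gt0 R.
rewrite /polar_angle /=; case: (leP 0 y) => [y_ge0|y_lt0].
  split; first by apply/andP; split; lra.
  by rewrite /circle_point cosE sinE ger0_norm // -xE.
have acos_gt : 0 < acos c.
  rewrite acos_gt0 //; case/andP: c1 => -> /=; rewrite le_eqVlt => /orP[/eqP c1|//].
  by move: sinE; rewrite c1 acos1 sin0 mulr0 ltr0_norm // => /eqP; lra.
split; first by apply/andP; split; lra.
have -> : 2 * pi - acos c = - acos c + 2 * pi by ring.
by rewrite circle_point_turn /circle_point cosN sinN cosE mulrN sinE ltr0_norm // opprK -xE.
Qed.

(** Sorting the polar angles in [[0, 2 pi[] of the points enumerates the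
    configuration. *)
Lemma angular_enumeration_exists alpha N w : (0 < N)%N -> 0 < alpha ->
  configuration (circle alpha) N w ->
  exists theta, angular_enumeration alpha N w theta.
Proof.
move=> N0 a0 [wA cardw].
have angP p : p \in w -> _ := fun pw => polar_angleP a0 (wA p pw).
pose s := sort <=%R [seq polar_angle alpha p | p <- w].
have size_s : size s = N by rewrite size_sort size_map.
have mem_s x : x \in s = (x \in [seq polar_angle alpha p | p <- w]).
  by rewrite mem_sort.
have s_itv x : x \in s -> 0 <= x < 2 * pi.
  by rewrite mem_s => /mapP[p pw ->]; case: (angP p pw).
have sorted_s : sorted <%R s.
  rewrite sort_lt_sorted map_inj_in_uniq ?fset_uniq // => p q pw qw e.
  by case: (angP p pw) => _ <-; rewrite e; case: (angP q qw).
pose theta k := nth (nth 0 s 0 + 2 * pi) s k.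
have theta_in k : (k < N)%N -> theta k \in s by move=> kN; rewrite mem_nth ?size_s.
have thetaN : theta N = theta 0%N + 2 * pi.
  by rewrite /theta nth_default ?size_s // (set_nth_default 0) ?size_s.
exists theta; split=> [k kN||].
- have [kN1|kN1] := ltnP k.+1 N.
    by rewrite lt_sorted_ltn_nth // inE size_s.
  have -> : k.+1 = N by apply/eqP; rewrite eqn_leq kN.
  rewrite thetaN.
  by have /s_itv := theta_in _ N0; have /s_itv := theta_in _ kN; lra.
- exact: thetaN.
- apply/seteqP; split=> [p /= pw|p /= [k kN <-]].
    have ps : polar_angle alpha p \in s by rewrite mem_s map_f.
    exists (index (polar_angle alpha p) s); first by rewrite /= -size_s index_mem.
    by rewrite /theta nth_index //; case: (angP p pw).
  have := theta_in k kN; rewrite mem_s => /mapP[q qw ->].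
  by case: (angP q qw) => _ ->.
Qed.

(** * The energy as a sum over cyclic gaps *)

(** Increasing sequences of angles that advance by one turn every [N] steps:
    they list the points of a configuration cyclically and for ever, which
    removes the wrap-around from sums over pairs of points. *)
Definition winding N theta :=
  (forall k, theta k < theta k.+1) /\
  (forall k, theta (k + N)%N = theta k + 2 * pi).

Lemma angular_enumeration_unroll alpha N w theta : (0 < N)%N ->
  angular_enumeration alpha N w theta ->
  exists2 theta', winding N theta' & forall k, (k <= N)%N -> theta' k = theta k.
Proof.
move=> N0 [inc turn _].
pose theta' m := theta (m %% N)%N + (m %/ N)%:R * (2 * pi).
(* At [r = N] the quotient grows by one while the remainder drops to [0]; by
   [turn] the two changes cancel. *)
have theta'E q r : (r <= N)%N -> theta' (q * N + r)%N = theta r + q%:R * (2 * pi).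
  rewrite leq_eqVlt => /orP[/eqP ->|rN]; rewrite /theta' modnMDl divnMDl //.
    by rewrite modnn divnn N0 turn natrD /= mulrDl mul1r addrA addrAC.
  by rewrite modn_small // divn_small // addn0.
exists theta'; last by move=> k kN; rewrite -[k]/(0 * N + k)%N theta'E // mul0r addr0.
split=> k; rewrite (divn_eq k N); have kN := ltn_pmod k N0.
  by rewrite -addnS !theta'E ?(ltnW kN) // ltrD2r inc.
by rewrite addnAC -mulSnr !theta'E ?(ltnW kN) // -addn1 natrD; ring.
Qed.

Lemma winding_gap N theta i k : winding N theta -> (0 < k < N)%N ->
  0 < theta (i + k)%N - theta i < 2 * pi.
Proof.
move=> [inc turn] /andP[k0 kN].
have mono : {homo theta : m n / (m < n)%N >-> m < n}.
  by apply: homo_ltn => // y x z; exact: lt_trans.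
have := mono i (i + k)%N; rewrite -{1}[i]addn0 ltn_add2l => /(_ k0).
have := mono (i + k)%N (i + N)%N; rewrite ltn_add2l => /(_ kN).
by rewrite turn; lra.
Qed.

Lemma winding_sum_gap N theta k : winding N theta -> (0 < N)%N ->
  \sum_(i < N) (theta (i + k)%N - theta i) = #|'I_N|%:R * (k%:R * (2 * pi / N%:R)).
Proof.
move=> [_ turn] N0; rewrite sumrB -(big_mkord xpredT theta).
rewrite -(big_mkord xpredT (fun i => theta (i + k)%N)) (sum_shifted_window k turn).
rewrite addrAC subrr add0r card_ord -mulr_natl.
by field; rewrite pnatr_eq0 -lt0n.
Qed.

Lemma winding_uniq alpha N theta : 0 < alpha -> winding N theta ->
  uniq [seq circle_point alpha (theta k) | k <- iota 0 N].
Proof.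
move=> a0 wind; rewrite map_inj_in_uniq ?iota_uniq // => i j.
rewrite !mem_iota !add0n /= => iN jN.
wlog lt_ij : i j iN jN / (i < j)%N.
  move=> IH; case: (ltngtP i j) => // ij e; first exact: IH.
  by apply/esym/IH.
move=> e; have := @winding_gap N theta i (j - i)%N wind.
rewrite subnKC ?(ltnW lt_ij) // => /(_ ltac:(lia)).
by move/(circle_point_neq a0); rewrite e eqxx.
Qed.

(** Seen from the [i]-th point, the other points are the next [N - 1] ones of
    the winding sequence. *)
Lemma log_energy_winding s t alpha N w theta : 0 < alpha -> (0 < N)%N ->
  winding N theta ->
  [set` w]%classic = [set circle_point alpha (theta k) | k in `I_N]%classic ->
  log_energy s t euclidean_dist w =
  \sum_(1 <= k < N) \sum_(i < N)
    pair_energy s t (chord alpha (theta (i + k)%N - theta i)).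
Proof.
move=> a0 N0 wind ws.
pose p k := circle_point alpha (theta k).
have perm_w : perm_eq w [seq p k | k <- iota 0 N].
  apply: uniq_perm; rewrite ?fset_uniq ?(winding_uniq a0 wind) // => x.
  apply/idP/mapP => [xw|[k kN ->]].
    have : [set` w]%classic x by [].
    by rewrite ws => -[k kN <-]; exists k => //; rewrite mem_iota.
  change ([set` w]%classic (p k)); rewrite ws; exists k => //.
  by move: kN; rewrite mem_iota.
pose e x y := if x != y then pair_energy s t (euclidean_dist x y) else 0.
have -> : log_energy s t euclidean_dist w =
    \sum_(0 <= i < N) \sum_(0 <= j < N) e (p i) (p j).
  rewrite /log_energy (perm_big _ perm_w) big_map /= /index_iota subn0.
  apply: eq_bigr => i _; rewrite (perm_big _ perm_w) big_map /= big_mkcond /=.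
  exact: eq_bigr.
have inner i : \sum_(0 <= j < N) e (p i) (p j) =
    \sum_(1 <= k < N) pair_energy s t (chord alpha (theta (i + k)%N - theta i)).
  have period j : e (p i) (p (j + N)%N) = e (p i) (p j) + 0.
    by case: wind => _ turn; rewrite /p turn circle_point_turn addr0.
  have := sum_shifted_window i period; rewrite mul0rn addr0 => <-.
  rewrite big_ltn // add0n {1}/e eqxx add0r.
  apply: eq_big_nat => k k_itv; have gap := winding_gap i wind k_itv.
  by rewrite [(k + i)%N]addnC /e circle_point_neq // euclidean_dist_circle_point.
rewrite (eq_bigr _ (fun i _ => inner i)) exchange_big_nat /=.
by apply: eq_bigr => k _; rewrite big_mkord.
Qed.

(** * The energy of equally spaced points is the minimum *)

(** The factor [#|'I_N|] is [N] in the form that Jensen's inequality yields. *)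
Definition equally_spaced_energy s t alpha N : R :=
  \sum_(1 <= k < N)
    #|'I_N|%:R * pair_energy s t (chord alpha (k%:R * (2 * pi / N%:R))).

Lemma step_gt0 N : (0 < N)%N -> 0 < 2 * pi / N%:R :> R.
Proof. by move=> N0; rewrite divr_gt0 ?mulr_gt0 ?pi_gt0 ?ltr0n. Qed.

Lemma winding_arithmetic N a : (0 < N)%N ->
  winding N (fun k => a + k%:R * (2 * pi / N%:R)).
Proof.
move=> N0; split=> k; first by rewrite ltrD2l ltr_pM2r ?step_gt0 // ltr_nat.
by rewrite natrD; field; rewrite pnatr_eq0 -lt0n.
Qed.

Lemma log_energy_arithmetic s t alpha N w a : 0 < alpha -> (0 < N)%N ->
  [set` w]%classic =
    [set circle_point alpha (a + k%:R * (2 * pi / N%:R)) | k in `I_N]%classic ->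
  log_energy s t euclidean_dist w = equally_spaced_energy s t alpha N.
Proof.
move=> a0 N0 ws; rewrite (log_energy_winding s t a0 N0 (winding_arithmetic a N0) ws).
apply: eq_bigr => k _.
rewrite [RHS]mulr_natl -sumr_const; apply: eq_bigr => i _.
by congr (pair_energy _ _ (chord _ _)); rewrite natrD; ring.
Qed.

Lemma equally_spaced_arithmetic alpha N w : 0 < alpha -> (0 < N)%N ->
  equally_spaced alpha N w ->
  exists a, [set` w]%classic =
    [set circle_point alpha (a + k%:R * (2 * pi / N%:R)) | k in `I_N]%classic.
Proof.
move=> a0 N0 [theta [_ _ ws] step]; exists (theta 0%N).
have thetaE k : (k <= N)%N -> theta k = theta 0%N + k%:R * (2 * pi / N%:R).
  elim: k => [|k IHk] kN; first by rewrite mul0r addr0.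
  rewrite -natr1 mulrDl mul1r addrA -IHk ?(ltnW kN) //.
  apply/eqP; rewrite [theta k + _]addrC -subr_eq; apply/eqP.
  apply: (mulfI (lt0r_neq0 a0)); rewrite step //.
  by field; rewrite pnatr_eq0 -lt0n.
by rewrite ws; apply/seteqP; split=> _ [k /= kN <-]; exists k => //;
  rewrite (thetaE k (ltnW kN)).
Qed.

Lemma log_energy_equally_spaced s t alpha N w : 0 < alpha -> (0 < N)%N ->
  equally_spaced alpha N w ->
  log_energy s t euclidean_dist w = equally_spaced_energy s t alpha N.
Proof.
by move=> a0 N0 /(equally_spaced_arithmetic a0 N0)[a]; exact: log_energy_arithmetic.
Qed.

Lemma equally_spaced_configuration s t alpha N : 0 < alpha -> (0 < N)%N ->
  exists2 w, configuration (circle alpha) N w &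
    log_energy s t euclidean_dist w = equally_spaced_energy s t alpha N.
Proof.
move=> a0 N0.
have wind := winding_arithmetic 0 N0.
pose theta k : R := 0 + k%:R * (2 * pi / N%:R).
pose l := [seq circle_point alpha (theta k) | k <- iota 0 N].
exists [fset p in l]%fset; first split=> [p /=|].
- by rewrite inE /= => /mapP[k _ ->]; exact: circle_point_on_circle.
- by rewrite card_fseq undup_id ?winding_uniq // size_map size_iota.
apply: (@log_energy_arithmetic _ _ _ _ _ 0) => //.
apply/seteqP; split=> [p /=|_ [k /= kN <-]].
- by rewrite inE /= => /mapP[k kN ->]; exists k => //=; rewrite mem_iota in kN.
- by rewrite /= inE /=; apply/mapP; exists k; rewrite ?mem_iota.
Qed.

(** For each [k], the [N] gaps between points [k] steps apart sum to [k] turns,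
    so Jensen's inequality bounds their contribution below by its equally spaced
    value. Equality in the part [k = 1] alone makes all consecutive gaps equal. *)
Lemma log_energy_ge s t alpha N w : (2 <= N)%N -> 0 <= s -> 1 <= t ->
  0 < alpha < 1 / 2 -> configuration (circle alpha) N w ->
  equally_spaced_energy s t alpha N <= log_energy s t euclidean_dist w /\
  (log_energy s t euclidean_dist w <= equally_spaced_energy s t alpha N ->
   equally_spaced alpha N w).
Proof.
move=> N2 s0 t1 /[dup] a_itv /andP[a0 _] wconf.
have N0 : (0 < N)%N by exact: ltnW.
have [theta enum_w] := angular_enumeration_exists N0 a0 wconf.
have [theta' wind theta'E] := angular_enumeration_unroll N0 enum_w.
have ws : [set` w]%classic =
    [set circle_point alpha (theta' k) | k in `I_N]%classic.
  case: enum_w => _ _ ->; apply/seteqP.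
  by split=> _ [k /= kN <-]; exists k; rewrite ?theta'E // ltnW.
have jensen k : (0 < k < N)%N ->
    #|'I_N|%:R * pair_energy s t (chord alpha (k%:R * (2 * pi / N%:R))) <=
    \sum_(i < N) pair_energy s t (chord alpha (theta' (i + k)%N - theta' i))
    ?= iff [forall i : 'I_N, theta' (i + k)%N - theta' i == k%:R * (2 * pi / N%:R)].
  move=> k_itv.
  apply: (leif_sum_supporting_line (D := fun y => 0 < y < 2 * pi)
    (g := fun y => pair_energy s t (chord alpha y))).
  - apply: pair_energy_gt_line => //.
    have := winding_gap 0 (winding_arithmetic 0 N0) k_itv.
    by rewrite add0n mul0r addr0 add0r subr0.
  - by move=> i; exact: winding_gap wind k_itv.
  - exact: winding_sum_gap.
rewrite (log_energy_winding s t a0 N0 wind ws) /equally_spaced_energy.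
rewrite !(big_ltn N2).
have tail : \sum_(2 <= k < N)
      #|'I_N|%:R * pair_energy s t (chord alpha (k%:R * (2 * pi / N%:R))) <=
    \sum_(2 <= k < N) \sum_(i < N)
      pair_energy s t (chord alpha (theta' (i + k)%N - theta' i)).
  by apply: ler_sum_nat => k /andP[k2 kN]; apply: (jensen k _).1; rewrite kN andbT ltnW.
have jensen1 := jensen 1%N N2.
split=> [|le_E]; first exact: lerD jensen1.1 tail.
have : [forall i : 'I_N, theta' (i + 1)%N - theta' i == 1%:R * (2 * pi / N%:R)].
  by rewrite -(ge_leif jensen1); lra.
move=> /forallP steps; exists theta => // k kN.
have := steps (Ordinal kN); rewrite /= addn1 !theta'E ?(ltnW kN) // mul1r => /eqP ->.
by field; rewrite pnatr_eq0 -lt0n.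
Qed.

End Angles.

Theorem proposition2p3 (R : realType) (N : nat) (s t alpha : R)
    (w : {fset R * R}) :
  (2 <= N)%N -> 0 <= s -> 1 <= t -> 0 < alpha -> alpha < 1 / 2 ->
  minimal_configuration s t (circle alpha) euclidean_dist N w <->
  configuration (circle alpha) N w /\ equally_spaced alpha N w.
Proof.
move=> N2 s0 t1 a0 a1; have N0 : (0 < N)%N by exact: ltnW.
have a_itv : 0 < alpha < 1 / 2 by rewrite a0.
split=> [[wconf wmin]|[wconf weq]]; split=> //.
- have [w0 w0conf w0E] := equally_spaced_configuration s t a0 N0.
  apply: (log_energy_ge N2 s0 t1 a_itv wconf).2.
  by rewrite -w0E; exact: wmin.
- move=> w' w'conf; rewrite (log_energy_equally_spaced s t a0 N0 weq).
  exact: (log_energy_ge N2 s0 t1 a_itv w'conf).1.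
Qed.
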